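(* Let $X$ be a compact metric space and let $F:X\to 2^X$ be upper semi-continuous. If there exist an infinite set $A\subseteq X$ and a $k\in\mathbb{N}$ such that $F^k(a)\supseteq A$ for all $a\in A$, then $h(F)=\infty$.
   Context: $\mathbb{N}=\{1,2,\ldots\}$. For a compact metric space $X$ with metric $d$, $2^X$ is the set of non-empty compact subsets of $X$. $F:X\to 2^X$ is upper semi-continuous if for every $x\in X$ and every open $V\subseteq X$ containing $F(x)$ there is an open $U\ni x$ with $F(t)\subseteq V$ for all $t\in U$. Iterates: $F^0$ is the identity and $F^n=F\circ F^{n-1}$, where $(G\circ F)(x)=\bigcup_{y\in F(x)}G(y)$. Entropy: for $n\in\mathbb{N}$, $\mathrm{Orb}_n(X,F)$ is the set of $n$-orbits, i.e. finite sequences $(x_0,\ldots,x_{n-1})$ in $X$ with $x_{i+1}\in F(x_i)$ for $0\le i\le n-2$, with the metric $D(\mathbf{x},\mathbf{y})=\max_{0\le i\le n-1}d(x_i,y_i)$. A subset of a metric space is $\epsilon$-separated if any two of its distinct points are at distance $\ge\epsilon$. $s_{n,\epsilon}(F)$ is the largest cardinality of an $\epsilon$-separated subset of $(\mathrm{Orb}_n(X,F),D)$, and the topological entropy of $F$ is $h(F)=\lim_{\epsilon\to0}\limsup_{n\to\infty}\frac1n\log s_{n,\epsilon}(F)\in[0,\infty]$. *)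

(* Defs.v *)
From HB Require Import structures.
From mathcomp Require Import all_boot all_order all_algebra.
From mathcomp Require Import all_classical all_reals all_analysis.
Import Order.TTheory GRing.Theory Num.Theory.
Import numFieldNormedType.Exports.

Set Implicit Arguments.
Unset Strict Implicit.
Unset Printing Implicit Defensive.

Local Open Scope classical_set_scope.
Local Open Scope ring_scope.

(* 2^X *)
Definition hyperspace (X : topologicalType) : set (set X) :=
  [set K | K !=set0 /\ compact K].

Definition upper_semicontinuous (X : topologicalType) (F : X -> set X) : Prop :=
  forall (x : X) (V : set X), open V -> F x `<=` V ->
    exists U : set X, [/\ open U, U x & forall t, U t -> F t `<=` V].

Definition setval_comp (X Y Z : Type) (G : Y -> set Z) (F : X -> set Y) :
    X -> set Z :=
  fun x => \bigcup_(y in F x) G y.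

Fixpoint setval_iter (X : Type) (F : X -> set X) (n : nat) : X -> set X :=
  if n is m.+1 then setval_comp F (setval_iter F m) else fun x => [set x].

Definition orbits (X : Type) (F : X -> set X) (n : nat) : set ('I_n -> X) :=
  [set x | forall i j : 'I_n, j = i.+1 :> nat -> F (x i) (x j)].
Arguments orbits {X} F n.

(* As distances are nonnegative, the base value 0 of the iterated maximum only
   matters for n = 0. *)
Definition orbit_dist (R : realType) (X : metricType R) (n : nat)
    (x y : 'I_n -> X) : R :=
  \big[Num.max/0]_(i < n) mdist (x i) (y i).

Arguments orbit_dist {R X n} x y.

Definition separated (R : realType) (T : Type) (dist : T -> T -> R) (eps : R)
    (S : set T) : Prop :=
  forall x y, S x -> S y -> x <> y -> eps <= dist x y.

(* The largest cardinality of a separated set, as an extended real. For compact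
   X and eps > 0 these cardinalities are bounded, so that the supremum is a
   maximum. *)
Definition sep_number (R : realType) (X : metricType R) (F : X -> set X)
    (n : nat) (eps : R) : \bar R :=
  ereal_sup [set (m%:R)%:E | m in
    [set m : nat | exists S : set ('I_n -> X),
      [/\ S `<=` orbits F n, separated orbit_dist eps S &
         (S #= `I_m)%card]]].

(* The term n = 0 is irrelevant to the upper limit. The limit in eps always
   exists, since the upper limit is nonincreasing in eps. *)
Definition entropy (R : realType) (X : metricType R) (F : X -> set X) : \bar R :=
  lim (limn_esup (fun n : nat => ((n%:R^-1)%:E * lne (sep_number F n eps))%E)
    @[eps --> (0 : R)^'+]).

(* Main.v *)
Require Import Defs.
From mathcomp Require Import all_boot all_order all_algebra.
From mathcomp Require Import all_classical all_reals all_analysis.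
From mathcomp Require Import ring.
Import Order.TTheory GRing.Theory Num.Theory.
Import numFieldNormedType.Exports.
Local Open Scope classical_set_scope.
Local Open Scope ring_scope.

(** Fix [N] points of [A].  Since [F^k] leads from each of them to each of
    them, every word in these [N]
    letters is spelled out, at the times [0, k, 2k, ...], by some orbit of [F]
    ([setval_iter_orbit]).  Two different words give orbits that are, at one
    such time, at two different letters, so at every scale [eps] below the least
    distance between the letters there are [N ^ m] separated orbits of length
    [m * k] ([expn_le_sep_number]).  Hence the exponential growth rate at such a
    scale is at least [ln N / k] ([ln_le_growth_rate]).  As [A] is infinite, [N]
    is arbitrarily large while [k] stays fixed, so the growth rate tends to
    infinity with the scale tending to 0. *)

Lemma setval_iter_path (X : Type) (F : X -> set X) (k : nat) (a b : X) :
  setval_iter F k a b ->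
  exists p : nat -> X,
    [/\ p 0%N = a, p k = b & forall i, (i < k)%N -> F (p i) (p i.+1)].
Proof.
elim: k b => [b /= ->|k IH b [y /IH[p [p0 pk pF]] Fyb]].
  by exists (fun=> a).
exists (fun i => if (i <= k)%N then p i else b); split => //=.
  by rewrite ltnn.
move=> i; rewrite ltnS => ik'; have [->|ik] := eqVneq i k.
  by rewrite leqnn ltnn pk.
by rewrite ik' ltn_neqAle ik ik'; apply: pF; rewrite ltn_neqAle ik.
Qed.

(** The connecting paths are glued end to end: at time [i] the orbit is at the
    [i %% k]-th point of the path number [i %/ k]. *)
Lemma setval_iter_orbit (X : Type) (F : X -> set X) (k : nat) (s : nat -> X) :
  (0 < k)%N -> (forall j, setval_iter F k (s j) (s j.+1)) ->
  exists x : nat -> X,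
    (forall j, x (j * k)%N = s j) /\ (forall i, F (x i) (x i.+1)).
Proof.
move=> k0 sF.
have [p pP] := choice (fun j => setval_iter_path _ _ _ _ _ (sF j)).
exists (fun i => p (i %/ k)%N (i %% k)%N); split => [j|i].
  by rewrite mulnK// modnMl; have [] := pP j.
have [_ pk pF] := pP (i %/ k)%N.
have ik : (i %% k < k)%N by rewrite ltn_mod.
have iE : i.+1 = ((i %/ k) * k + (i %% k).+1)%N by rewrite addnS -divn_eq.
have [lt_k|] := ltnP (i %% k).+1 k.
  rewrite iE divnMDl// modnMDl (modn_small lt_k) (divn_small lt_k) addn0.
  exact: pF.
rewrite leq_eqVlt ltnS leqNgt ik orbF => /eqP kE.
(* The step that leaves a block: the next path starts where this one ends. *)
rewrite iE -kE divnMDl// modnMDl modnn divnn k0 addn1.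
have [-> _ _] := pP (i %/ k).+1.
by have := pF _ ik; rewrite -kE pk.
Qed.

(** Each word [w] of length [m] in the letters [a i] has an orbit passing through
    its [j]-th letter at time [j * k].  Since the time [j * k] is below [m * k]
    whenever [j < m], an orbit of length [m * k] sees all the letters of its
    word, and the positions where two words differ keep their orbits apart. *)
Lemma expn_le_sep_number (R : realType) (X : metricType R) (F : X -> set X)
    (N k m : nat) (a : 'I_N.+1 -> X) (eps : R) :
  (0 < k)%N -> 0 < eps ->
  (forall i j, setval_iter F k (a i) (a j)) ->
  (forall i j, i != j -> eps <= mdist (a i) (a j)) ->
  (((N.+1 ^ m)%N%:R)%:E <= sep_number F (m * k) eps)%E.
Proof.
move=> k0 eps0 aF asep.
pose word := {ffun 'I_m -> 'I_N.+1}.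
(* The gluing lemma wants an infinite itinerary, so a word is prolonged
   beyond its length by a constant letter. *)
pose letter (w : word) (j : nat) := a (oapp w ord0 (insub j)).
have [g gP] := choice (fun w : word =>
  setval_iter_orbit _ F k (letter w) k0 (fun j => aF _ _)).
pose orb (w : word) : 'I_(m * k) -> X := fun i => g w i.
have orb_sep w w' : w != w' ->
    exists i, eps <= mdist (orb w i) (orb w' i).
  move=> ww'; have /existsP[j jP] : [exists j, w j != w' j].
    apply: contra_neqT ww' => /existsPn wE.
    by apply/ffunP => j; apply/eqP; have := wE j; rewrite negbK.
  have jk : (j * k < m * k)%N by rewrite ltn_pmul2r.
  exists (Ordinal jk); rewrite /orb /=.
  have [-> _] := gP w; have [-> _] := gP w'.
  by rewrite /letter valK /=; exact: asep.
have orb_inj : injective orb.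
  move=> w w' E; apply/eqP/negPn/negP => /orb_sep[i].
  by rewrite E mdistxx leNgt eps0.
apply: ereal_sup_ubound; exists (N.+1 ^ m)%N => //; exists (range orb); split.
- move=> _ [w _ <-] i j jE; rewrite /orb jE; exact: (gP w).2.
- move=> _ _ [w _ <-] [w' _ <-] ne.
  have /orb_sep[i] : w != w' by apply: contra_not_neq ne => ->.
  move=> /le_trans; apply.
  exact: (le_bigmax _ (fun i => mdist (orb w i) (orb w' i))).
- apply: card_eq_trans (inj_card_eq (in2W orb_inj)) _.
  have -> : (N.+1 ^ m = #|word|)%N by rewrite card_ffun !card_ord.
  apply: card_eq_trans (card_esym card_II).
  apply: card_eq_trans (card_esym (inj_card_eq (in2W (@enum_rank_inj word)))) _.
  suff -> : range (@enum_rank word) = setT by [].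
  by apply/seteqP; split => // i _; exists (enum_val i) => //; exact: enum_valK.
Qed.

Lemma limn_esup_ge_frequently (R : realType) (u : nat -> \bar R) (c : \bar R) :
  (forall n0, exists2 n, (n0 <= n)%N & (c <= u n)%E) -> (c <= limn_esup u)%E.
Proof.
move=> uP; apply: le_ereal_inf_tmp => _ [V [n0 _ n0V] <-].
have [n n0n /le_trans] := uP n0; apply.
by apply: ereal_sup_ubound; exists n => //; exact: n0V.
Qed.

(** Along the times [n = m * k] the rate is at least
    [ln (N.+1 ^ m) / (m * k) = ln N.+1 / k], whatever [m]; an upper limit sees
    such a subsequence. *)
Lemma ln_le_growth_rate (R : realType) (X : metricType R) (F : X -> set X)
    (N k : nat) (a : 'I_N.+1 -> X) (eps : R) :
  (0 < k)%N -> 0 < eps ->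
  (forall i j, setval_iter F k (a i) (a j)) ->
  (forall i j, i != j -> eps <= mdist (a i) (a j)) ->
  ((ln N.+1%:R / k%:R)%:E <=
    limn_esup (fun n : nat => ((n%:R^-1)%:E * lne (sep_number F n eps))%E))%E.
Proof.
move=> k0 eps0 aF asep; apply: limn_esup_ge_frequently => n0.
exists (n0.+1 * k)%N; first by rewrite (leq_trans (leqnSn _))// leq_pmulr.
have sep := expn_le_sep_number _ _ _ _ _ n0.+1 _ _ k0 eps0 aF asep.
have N0 : (0 : R) < (N.+1 ^ n0.+1)%N%:R by rewrite ltr0n expn_gt0.
have le_lne : ((ln ((N.+1 ^ n0.+1)%N%:R : R))%:E <=
    lne (sep_number F (n0.+1 * k) eps))%E.
  rewrite -lne_EFin// lee_lne// in_itv/= leey andbT.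
    by rewrite lee_fin ltW.
  by rewrite (le_trans _ sep)// lee_fin ltW.
apply: le_trans (lee_wpmul2l _ le_lne); last by rewrite lee_fin invr_ge0.
rewrite -EFinM lee_fin natrX lnXn// -mulr_natr natrM.
rewrite le_eqVlt; apply/orP; left; apply/eqP; field.
by rewrite pnatr_eq0 -lt0n k0 addrC natr1 pnatr_eq0.
Qed.

Theorem corollary7p2 (R : realType) (X : metricType R) (F : X -> set X)
    (Xcompact : compact [set: X])
    (Fval : forall x : X, hyperspace (F x))
    (Fusc : upper_semicontinuous F)
    (hA : exists (A : set X) (k : nat),
       [/\ infinite_set A, (0 < k)%N &
           forall a : X, A a -> A `<=` setval_iter F k a]) :
  entropy F = +oo%E.
Proof.
have [A [k [Ainf k0 AF]]] := hA.
have /infiniteP/card_leP[f] := Ainf.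
apply/cvg_lim => //; apply/cvgeyPge => M.
(* Enough letters for the rate [ln N.+1 / k] to exceed the bound [M]. *)
pose N := Num.truncn (expR (M * k%:R)).
pose a (i : 'I_N.+1) : X := \val (f (to_setT (i : nat))).
have aA i : A (a i) by exact: set_valP.
have aF i j : setval_iter F k (a i) (a j) by exact: AF.
have a_inj : injective a.
  move=> i j /val_inj/(inj (mem_setT _) (mem_setT _)).
  by move=> /(congr1 val)/= /val_inj.
have M_le : M <= ln N.+1%:R / k%:R.
  rewrite ler_pdivlMr ?ltr0n// -[leLHS]expRK ler_ln ?posrE ?expR_gt0//.
  by rewrite ltW// Num.Theory.truncnS_gt.
(* Only finitely many pairs of letters bound the scale from above. *)
have asep : \forall eps \near (0 : R)^'+,
    forall i j, i != j -> eps <= mdist (a i) (a j).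
  apply: filter_forall => i; apply: filter_forall => j.
  have [->|ij] := eqVneq i j; first exact: nearW.
  near=> eps => _; near: eps; apply: nbhs_right_le.
  by rewrite mdist_gt0 (inj_eq a_inj).
near=> eps.
have eps0 : 0 < eps by [].
apply: le_trans (ln_le_growth_rate _ _ _ _ _ _ _ k0 eps0 aF _).
  by rewrite lee_fin.
by near: eps.
Unshelve. all: by end_near.
Qed.
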